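(* Let $\mathbb X,\mathbb Y$ be Banach spaces, $\mathbf A\colon\mathbb X\to\mathbb Y$ a bounded linear operator, and $\mathbf B\colon\operatorname{ran}(\mathbf A)\to\mathbb X$ a linear right inverse of $\mathbf A$ with range $\mathbb U:=\operatorname{ran}(\mathbf B)$, such that $\mathbb X=\mathbb U\oplus\ker(\mathbf A)$ is a topological direct sum. Let $\mathbf P_{\ker(\mathbf A)}$ be the bounded linear projection onto $\ker(\mathbf A)$ along $\mathbb U$. Let $\mathcal D\colon\mathbb Y\times\mathbb Y\to[0,\infty]$ be a functional, let $\mathbb U^*\subseteq\mathbb U$, and let $(\mathbf R_\delta)_{\delta>0}$ be a regularization method on the signal class $\mathbb U^*$ with respect to the similarity measure $\mathcal D$. Let $\mathbf\Phi=\mathrm{Id}_{\mathbb X}+\mathbf P_{\ker(\mathbf A)}\circ\mathbf N$ be a null space network, where $\mathbf N\colon\mathbb X\to\mathbb X$ is Lipschitz continuous. Then the family $(\mathbf\Phi\circ\mathbf R_\delta)_{\delta>0}$ is a regularization method on the signal class $\mathbf\Phi(\mathbb U^* )$ with respect to the similarity measure $\mathcal D$.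
   Context: A (possibly nonlinear) map $\mathbf B\colon\operatorname{ran}(\mathbf A)\to\mathbb X$ is a right inverse of $\mathbf A$ if $\mathbf A(\mathbf B(\mathbf y))=\mathbf y$ for all $\mathbf y\in\operatorname{ran}(\mathbf A)$. Regularization method: a family $(\mathbf R_\delta)_{\delta>0}$ of maps $\mathbf R_\delta\colon\mathbb Y\to\mathbb X$ is a regularization method (for recovering $\mathbf x$ from noisy data of $\mathbf A(\mathbf x)$) on a signal class $\mathbb M^*$ with respect to $\mathcal D$ if $$\forall \mathbf x\in\mathbb M^*:\quad \lim_{\delta\to0}\ \sup\bigl\{\|\mathbf x-\mathbf R_\delta(\mathbf y^\delta)\| \;:\; \mathbf y^\delta\in\mathbb Y,\ \mathcal D(\mathbf A(\mathbf x),\mathbf y^\delta)\le\delta\bigr\}=0.$$ Here $\mathbb M^*$ is required to be a subset of the range of some right inverse of $\mathbf A$: for $(\mathbf R_\delta)_{\delta>0}$ this right inverse is $\mathbf B$, with $\mathbb U^*\subseteq\operatorname{ran}(\mathbf B)$; for $(\mathbf\Phi\circ\mathbf R_\delta)_{\delta>0}$ it is $\mathbf\Phi\circ\mathbf B$, with $\mathbf\Phi(\mathbb U^* )\subseteq\operatorname{ran}(\mathbf\Phi\circ\mathbf B)$. *)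

(* Defs.v *)
From HB Require Import structures.
From mathcomp Require Import all_boot all_order all_algebra.
From mathcomp Require Import all_classical all_reals all_analysis.

Set Implicit Arguments.
Unset Strict Implicit.
Unset Printing Implicit Defensive.

Import Order.TTheory GRing.Theory Num.Theory.
Import numFieldNormedType.Exports.

Local Open Scope classical_set_scope.
Local Open Scope ring_scope.

Section Definitions.
Variables (R : realType) (X Y : normedModType R).

Definition ker (V W : normedModType R) (f : V -> W) : set V :=
  f @^-1` [set 0].

(* Maps defined on ran(A) have the subtype of elements of [range A] as domain. *)
Definition is_right_inverse (A : X -> Y) (B : range A -> X) :=
  forall y : range A, A (B y) = val y.

(* [val] embeds ran(A) in Y, so the premise says y3 = a y1 + y2 in ran(A). *)
Definition linear_on_range (A : X -> Y) (B : range A -> X) :=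
  forall (a : R) (y1 y2 y3 : range A),
    val y3 = a *: val y1 + val y2 -> B y3 = a *: B y1 + B y2.

Definition sum_map (U V : set X) (p : U * V) : X := val p.1 + val p.2.

(* U and V carry the topology induced by X, and U * V the product topology. *)
Definition topological_direct_sum (U V : set X) :=
  [/\ submod_closed [in U], submod_closed [in V], continuous (@sum_map U V) &
      exists s : X -> U * V,
        [/\ cancel (@sum_map U V) s, cancel s (@sum_map U V) & continuous s]].

Definition is_projection_along (P : {linear X -> X}) (V U : set X) :=
  [/\ P \o P = P, range P = V & ker P = U].

Definition null_space_network (P : {linear X -> X}) (N : X -> X) : X -> X :=
  fun x => x + P (N x).

(* The supremum is the one of [0, +oo]: adding 0 to the set only makes it 0
   instead of -oo when no data satisfies the constraint. *)
Definition worst_case_error (A : X -> Y) (D : Y -> Y -> \bar R)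
    (Rd : R -> Y -> X) (x : X) (delta : R) : \bar R :=
  ereal_sup ([set 0%E] `|`
    [set `|x - Rd delta y|%:E | y in [set y | (D (A x) y <= delta%:E)%E]]).

(* Only the values of [Rd] at delta > 0 matter, the limit being at 0^'+. *)
Definition regularization_method (A : X -> Y) (D : Y -> Y -> \bar R)
    (B : range A -> X) (M : set X) (Rd : R -> Y -> X) :=
  [/\ is_right_inverse B, M `<=` range B &
      forall x, M x ->
        worst_case_error A D Rd x delta @[delta --> 0^'+] --> 0%E].

End Definitions.

(* Main.v *)
(* The range of P is ker A, so Phi = Id + P o N changes no data: A o Phi = A.
   Hence Phi o B is again a right inverse of A, and the data admissible for
   Phi x are those admissible for x. As Phi is Lipschitz with some constant k,
   the worst-case error of Phi o R_delta at Phi x is at most k times that of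
   R_delta at x, which tends to 0. *)

Require Import Defs.
From HB Require Import structures.
From mathcomp Require Import all_boot all_order all_algebra.
From mathcomp Require Import all_classical all_reals all_analysis.

Set Implicit Arguments.
Unset Strict Implicit.
Unset Printing Implicit Defensive.

Import Order.TTheory GRing.Theory Num.Theory.
Import numFieldNormedType.Exports.

Local Open Scope classical_set_scope.
Local Open Scope ring_scope.

Lemma klipschitzD (R : realType) (V W : normedModType R) (k l : R)
    (f g : V -> W) :
  k.-lipschitz f -> l.-lipschitz g -> (k + l).-lipschitz (f \+ g).
Proof.
move=> fk gl xy xyT /=; rewrite opprD addrACA mulrDl.
by rewrite (le_trans (ler_normD _ _))// lerD//; [exact: fk|exact: gl].
Qed.

Lemma klipschitz_comp (R : realType) (U V W : normedModType R) (k l : R)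
    (f : V -> W) (g : U -> V) : 0 <= k ->
  k.-lipschitz f -> l.-lipschitz g -> (k * l).-lipschitz (f \o g).
Proof.
move=> k0 fk gl xy xyT /=; rewrite -mulrA.
apply: (le_trans (fk (g xy.1, g xy.2) _)) => //=.
by rewrite ler_wpM2l//; exact: gl.
Qed.

(** Boundedness on balls gives an operator bound, and linearity turns a bound on the norm of [f]
    into one on its increments. *)
Lemma linear_bounded_klipschitz (R : realType) (V W : normedModType R)
    (f : {linear V -> W}) :
  bounded_fun_norm f -> exists2 k, 0 < k & k.-lipschitz f.
Proof.
move=> /bounded_funP /linear_boundedP /pinfty_ex_gt0[k k0 fk].
by exists k => // xy _ /=; rewrite -linearB.
Qed.

Lemma lipschitz_null_space_network (R : realType) (X : normedModType R)
    (P : {linear X -> X}) (N : X -> X) :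
  bounded_fun_norm P -> lipschitz N ->
  exists2 k, 0 < k & k.-lipschitz (null_space_network P N).
Proof.
move=> /linear_bounded_klipschitz[k k0 Pk] /pinfty_ex_gt0[l l0 Nl].
(* The identity contributes 1, and [P \o N] contributes [k * l]. *)
exists (1 + k * l); first by rewrite addr_gt0// mulr_gt0.
exact: (klipschitzD lipschitz_id (klipschitz_comp (ltW k0) Pk Nl)).
Qed.

Lemma null_space_network_data (R : realType) (X Y : normedModType R)
    (A : {linear X -> Y}) (P : {linear X -> X}) (N : X -> X) (x : X) :
  range P `<=` ker A -> A (null_space_network P N x) = A x.
Proof.
move=> PA; have AP : A (P (N x)) = 0 by apply: PA; exists (N x).
by rewrite linearD AP addr0.
Qed.

(** The adjoined 0 gives this bound even when no data are admissible. *)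
Lemma worst_case_error_ge0 (R : realType) (X Y : normedModType R) (A : X -> Y)
    (D : Y -> Y -> \bar R) (Rd : R -> Y -> X) (x : X) (delta : R) :
  (0 <= worst_case_error A D Rd x delta)%E.
Proof. by apply: ereal_sup_ubound; left. Qed.

Lemma worst_case_error_comp (R : realType) (X Y : normedModType R) (A : X -> Y)
    (D : Y -> Y -> \bar R) (Rd : R -> Y -> X) (F : X -> X) (k : R) (x : X)
    (delta : R) : 0 <= k -> k.-lipschitz F -> A (F x) = A x ->
  (worst_case_error A D (fun d => F \o Rd d) (F x) delta <=
   k%:E * worst_case_error A D Rd x delta)%E.
Proof.
move=> k0 Fk AFx; apply: ge_ereal_sup => _ [->|[y /= Dy <-]].
  (* This is the adjoined element 0; the other case is the error of an admissible [y]. *)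
  by rewrite mule_ge0// ?lee_fin// worst_case_error_ge0.
(* Data admissible for [F x] thus become admissible for [x], so [y] competes in both suprema. *)
rewrite AFx in Dy.
apply: (@le_trans _ _ (k%:E * `|x - Rd delta y|%:E)%E).
  by rewrite -EFinM lee_fin; exact: (Fk (x, Rd delta y)).
by rewrite lee_wpmul2l ?lee_fin//; apply: ereal_sup_ubound; right; exists y.
Qed.

Theorem theorem3p5 (R : realType) (X Y : completeNormedModType R)
    (A : {linear X -> Y}) (hA : bounded_fun_norm A)
    (B : range A -> X) (hBlin : linear_on_range B) (hB : is_right_inverse B)
    (hsum : topological_direct_sum (range B) (ker A))
    (P : {linear X -> X}) (hPbnd : bounded_fun_norm P)
    (hP : is_projection_along P (ker A) (range B))
    (D : Y -> Y -> \bar R) (hD : forall y z, (0 <= D y z)%E)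
    (Ustar : set X) (hUstar : Ustar `<=` range B)
    (Rd : R -> Y -> X) (hRd : regularization_method D B Ustar Rd)
    (N : X -> X) (hN : lipschitz N) :
  regularization_method D (null_space_network P N \o B)
    (null_space_network P N @` Ustar)
    (fun delta => null_space_network P N \o Rd delta).
Proof.
case: hP => _ Pker _; case: hRd => _ _ Rd0.
have [k k0 Phik] := lipschitz_null_space_network hPbnd hN.
have APhi x : A (null_space_network P N x) = A x.
  by apply: null_space_network_data; rewrite Pker.
split.
- by move=> y /=; rewrite APhi hB.
(* Writing [x] as [B y] exhibits its image as the value of the new right inverse at the same [y]. *)
- by move=> _ [x /hUstar[y _ <-] <-]; exists y.
- move=> _ [x Ux <-].
  have kRd0 : (k%:E * worst_case_error A D Rd x delta)%E @[delta --> 0^'+]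
      --> 0%E.
    (* Since [k] is finite and independent of [delta], scaling by it preserves the limit 0 in the
       extended reals. *)
    by rewrite -[X in _ --> X](mule0 k%:E); apply: cvgeZl => //; exact: Rd0.
  (* The new error lies between 0 and [k] times the old one. *)
  apply: squeeze_cvge (cvg_cst 0%E) kRd0; near=> delta.
  by rewrite worst_case_error_ge0 worst_case_error_comp// ltW.
Unshelve. all: by end_near. Qed.
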